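(* Let $X$ be an absolutely continuous random variable with probability density function $f$, cumulative distribution function $F$, support $(a,b)$ with $-\infty\le a<b<\infty$, finite second-order moment, and reversed hazard rate $\phi$. Then $$E\left[\frac{1}{\phi(X)}\right]\ \ge\ \frac{1}{E[\phi(X)]}.$$ Equality holds if and only if, for a suitable choice of the constant $\gamma>0$, $X$ follows the Type 3 extreme value distribution with cumulative distribution function $$F(t)=\begin{cases}e^{\gamma(t-b)}, & t\in(-\infty,b],\ b\ge 0,\\ 1, & \text{otherwise.}\end{cases}$$
   Context: The support of $X$ is $(a,b)$ where $a=\inf\{t:F(t)>0\}$ and $b=\sup\{t:F(t)<1\}$. The reversed hazard rate of $X$ is $\phi(t)=f(t)/F(t)$, where defined.
   Formalization: The equality clause is stated assuming f > 0 almost everywhere on (a,b), since a density with a gap can have φ(X) constant and give equality; the condition b ≥ 0 is dropped, since the same distribution with b < 0 also gives equality. *)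

(* Defs.v *)
From HB Require Import structures.
From mathcomp Require Import all_boot all_order all_algebra.
From mathcomp Require Import all_classical all_reals all_analysis.

Set Implicit Arguments.
Unset Strict Implicit.
Unset Printing Implicit Defensive.

Import Order.TTheory GRing.Theory Num.Theory.
Import numFieldNormedType.Exports.

Local Open Scope classical_set_scope.
Local Open Scope ring_scope.

(* The existence of such an [f] is the absolute continuity of [X]. *)
Definition is_density (d : measure_display) (T : measurableType d)
    (R : realType) (P : probability T R) (X : {RV P >-> R}) (f : R -> R) :=
  [/\ measurable_fun [set: R] f,
      forall t, 0 <= f t &
      forall A : set R, measurable A ->
        distribution P X A = (\int[lebesgue_measure]_(t in A) (f t)%:E)%E].

(* The endpoints range over [\bar R], so that [a = -oo] is allowed. *)
Definition has_support (d : measure_display) (T : measurableType d)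
    (R : realType) (P : probability T R) (X : {RV P >-> R}) (a b : \bar R) :=
  a = ereal_inf [set t%:E | t in [set t : R | (0 < cdf X t)%E]] /\
  b = ereal_sup [set t%:E | t in [set t : R | (cdf X t < 1)%E]].

(* Where [F t = 0] the quotient takes the junk value 0; the law of [X] gives
   this set mass 0. The same holds for [(reversed_hazard X f t)^-1] on the set
   where [f t = 0]. *)
Definition reversed_hazard (d : measure_display) (T : measurableType d)
    (R : realType) (P : probability T R) (X : {RV P >-> R}) (f : R -> R)
    (t : R) : R :=
  f t / fine (cdf X t).

Definition type3_extreme_cdf (R : realType) (gamma b t : R) : R :=
  if t <= b then expR (gamma * (t - b)) else 1.

(* Main.v *)
(* Write F for the distribution function of X and phi = f / F. Almost surely
   Y := phi(X) is positive, and (Y - c)^2 / Y = c^2 / Y + Y - 2c with c := E[Y]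
   gives c^2 E[1/Y] - c = E[(Y - c)^2 / Y] >= 0, with equality iff Y = c almost
   surely. If phi(X) = c almost surely and f > 0 on (a, b), then f = c F almost
   everywhere on (-oo, b), so that F' = c F there, and F b = 1 forces
   F t = exp (c (t - b)). Conversely, if F is this exponential, Lebesgue's
   differentiation theorem gives f = F' = gamma F almost everywhere on
   (-oo, b), hence phi(X) = gamma almost surely. *)
Require Import Defs.
From HB Require Import structures.
From mathcomp Require Import all_boot all_order all_algebra.
From mathcomp Require Import all_classical all_reals all_analysis.
From mathcomp Require Import measurable_realfun ring.

Import Order.TTheory GRing.Theory Num.Theory.
Import numFieldNormedType.Exports.

Local Open Scope classical_set_scope.
Local Open Scope ring_scope.

Set Implicit Arguments.
Unset Strict Implicit.
Unset Printing Implicit Defensive.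

(* The library's hint does not see through the bare function
   [lebesgue_measure] to its canonical measure structure. *)
#[local] Instance lebesgue_ae_filter (R : realType) :
  Filter (almost_everywhere (@lebesgue_measure R)).
Proof. exact: (ae_filter_ringOfSetsType (@lebesgue_measure R)). Qed.

(** * Mean of the reciprocal of an almost surely positive variable *)

Lemma measurable_fun_inv_ge0 (d : measure_display) (T : measurableType d)
    (R : realType) (Y : T -> R) :
  measurable_fun [set: T] Y -> (forall w, 0 <= Y w) ->
  measurable_fun [set: T] (fun w => (Y w)^-1).
Proof.
(* On nonnegative reals the inverse is the power with exponent -1, also at 0, where both take the
   value 0. *)
move=> mY Y0; apply: (@eq_measurable_fun _ _ _ _ _ (fun w => Y w `^ (-1))).
  by move=> w _; rewrite powR_inv1.
exact: (measurableT_comp (measurable_powR _)).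
Qed.

(** A nonnegative variable of mean zero vanishes almost surely; together with positivity this would
    make the empty event almost sure. *)
Lemma ae_gt0_expectation_gt0 (d : measure_display) (T : measurableType d)
    (R : realType) (P : probability T R) (Y : T -> R) :
  measurable_fun [set: T] Y -> (forall w, 0 <= Y w) ->
  {ae P, forall w, 0 < Y w} -> (0 < 'E_P[Y])%E.
Proof.
move=> mY Y0 Ygt0; rewrite lt_neqAle expectation_ge0// andbT eq_sym unlock.
apply/negP => /eqP EY0.
have mEY : measurable_fun [set: T] (EFin \o Y) by exact/measurable_EFinP.
have /(ae_eq_integral_abs P measurableT mEY) Yae0 :
    (\int[P]_w `|(EFin \o Y) w| = 0)%E.
  rewrite -EY0; apply: eq_integral => w _ /=.
  by rewrite ger0_norm.
have : {ae P, forall w : T, False}.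
  apply: filterS2 Yae0 Ygt0 => w /= /(_ I) [->].
  by rewrite ltxx.
(* The almost-sure filter is proper because [P] has total mass 1, so it cannot contain the empty
   set. *)
have : ProperFilter (almost_everywhere P).
  apply: ae_properfilter_algebraOfSetsType.
  by rewrite [X in (_ < X)%E]probability_setT.
by move=> PF; exact: filter_not_empty.
Qed.

(** Integrates [c^2 / Y = (Y - c)^2 / Y + 2c - Y], an identity wherever [Y] is nonzero. The mean of
    [1 / Y] may be infinite. *)
Lemma expectation_inv_gap (d : measure_display) (T : measurableType d)
    (R : realType) (P : probability T R) (Y : T -> R) (c : R) :
  measurable_fun [set: T] Y -> (forall w, 0 <= Y w) ->
  {ae P, forall w, 0 < Y w} -> ('E_P[Y] = c%:E)%E ->
  ((c ^+ 2)%:E * 'E_P[fun w => (Y w)^-1%R] =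
   'E_P[fun w => ((Y w - c) ^+ 2 / Y w)%R] + c%:E)%E.
Proof.
move=> mY Y0 Ygt0 EY.
have c0 : 0 <= c by rewrite -lee_fin -EY expectation_ge0.
have mV := measurable_fun_inv_ge0 mY Y0.
have mg : measurable_fun [set: T] (fun w => (Y w - c) ^+ 2 / Y w).
  apply: measurable_funM => //.
  by apply: measurable_funX; apply: measurable_funB.
have g0 w : 0 <= (Y w - c) ^+ 2 / Y w by rewrite mulr_ge0 ?sqr_ge0 ?invr_ge0.
(* Without subtraction, every term is nonnegative, so expectations add with no integrability of
   [1 / Y]. The finite [c] is cancelled only at the end. *)
have E2 : ((c ^+ 2)%:E * 'E_P[fun w => (Y w)^-1%R] + c%:E =
   'E_P[fun w => ((Y w - c) ^+ 2 / Y w)%R] + (c *+ 2)%:E)%E.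
  rewrite -[in LHS]EY -[X in (_ + X)%E = _]/('E_P[Y])%E.
  rewrite -(expectation_cst P (c *+ 2)).
  rewrite unlock -ge0_integralZl//; last 3 first.
  - exact/measurable_EFinP.
  - by move=> w _; rewrite lee_fin invr_ge0.
  - by rewrite lee_fin sqr_ge0.
  rewrite -!ge0_integralD//.
  - apply: ge0_ae_eq_integral => //.
    + apply: emeasurable_funD; last exact/measurable_EFinP.
      by apply: measurable_funeM; exact/measurable_EFinP.
    + by apply: emeasurable_funD; exact/measurable_EFinP.
    + move=> w _; rewrite adde_ge0 ?mule_ge0 ?lee_fin ?invr_ge0//.
      exact: sqr_ge0.
    + move=> w _; rewrite adde_ge0 ?lee_fin//=.
      by rewrite mulrn_wge0.
    + apply: filterS Ygt0 => w Yw _; rewrite -!EFinM -!EFinD /=; congr EFin.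
      by field; rewrite gt_eqF.
  - by move=> w _; rewrite lee_fin.
  - exact/measurable_EFinP.
  - by move=> w _; rewrite lee_fin/= mulrn_wge0.
  - exact/measurable_EFinP.
  - by move=> w _; rewrite -EFinM lee_fin mulr_ge0 ?sqr_ge0 ?invr_ge0.
  - by apply: measurable_funeM; exact/measurable_EFinP.
  - by move=> w _; rewrite lee_fin.
  - exact/measurable_EFinP.
move: E2; rewrite mulr2n EFinD addeA => /(congr1 (fun x => x - c%:E)%E).
by rewrite !addeK.
Qed.

Lemma expectation_inv_ge (d : measure_display) (T : measurableType d)
    (R : realType) (P : probability T R) (Y : T -> R) :
  measurable_fun [set: T] Y -> (forall w, 0 <= Y w) ->
  {ae P, forall w, 0 < Y w} ->
  (('E_P[Y])^-1 <= 'E_P[fun w => (Y w)^-1%R])%E.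
Proof.
move=> mY Y0 Ygt0; have := ae_gt0_expectation_gt0 mY Y0 Ygt0.
case EY : ('E_P[Y])%E => [c| |]// c0.
  rewrite lte_fin in c0; rewrite inver gt_eqF//.
  rewrite -(@lee_pmul2l _ (c ^+ 2)%:E) ?lte_fin ?exprn_gt0//.
  rewrite (expectation_inv_gap mY Y0 Ygt0 EY) -EFinM expr2 mulfK ?gt_eqF//.
  rewrite leeDr// expectation_ge0// => w.
  by rewrite mulr_ge0 ?sqr_ge0 ?invr_ge0.
(* If the mean of [Y] is infinite, its inverse is 0 and only nonnegativity remains. *)
by rewrite invey expectation_ge0// => w; rewrite invr_ge0.
Qed.

(** Equality makes the gap [(Y - c)^2 / Y] integrate to 0, hence vanish almost surely. An infinite
    mean is excluded: it would force the positive variable [1 / Y] to have mean 0. *)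
Lemma expectation_inv_eq (d : measure_display) (T : measurableType d)
    (R : realType) (P : probability T R) (Y : T -> R) :
  measurable_fun [set: T] Y -> (forall w, 0 <= Y w) ->
  {ae P, forall w, 0 < Y w} ->
  ('E_P[fun w => (Y w)^-1%R] = ('E_P[Y])^-1)%E ->
  exists2 c, 0 < c & {ae P, forall w, Y w = c}.
Proof.
move=> mY Y0 Ygt0; have := ae_gt0_expectation_gt0 mY Y0 Ygt0.
have mV := measurable_fun_inv_ge0 mY Y0.
case EY : ('E_P[Y])%E => [c| |]// c0; last first.
  rewrite invey => EV0.
  have : (0 < 'E_P[fun w => (Y w)^-1%R])%E.
    apply: ae_gt0_expectation_gt0 => //; first by move=> w; rewrite invr_ge0.
    by apply: filterS Ygt0 => w; rewrite invr_gt0.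
  by rewrite EV0 ltxx.
rewrite lte_fin in c0; rewrite inver gt_eqF// => EV; exists c => //.
have := expectation_inv_gap mY Y0 Ygt0 EY.
rewrite EV -EFinM expr2 mulfK ?gt_eqF// => /(congr1 (fun x => x - c%:E)%E).
rewrite addeK// subee// unlock => /esym Eg.
have mg : measurable_fun [set: T] (EFin \o (fun w => (Y w - c) ^+ 2 / Y w)).
  apply/measurable_EFinP; apply: measurable_funM => //.
  by apply: measurable_funX; apply: measurable_funB.
have /(ae_eq_integral_abs P measurableT mg) gae0 :
    (\int[P]_w `|(EFin \o (fun w => (Y w - c) ^+ 2 / Y w)%R) w| = 0)%E.
  rewrite -Eg; apply: eq_integral => w _ /=.
  by rewrite ger0_norm// mulr_ge0 ?sqr_ge0 ?invr_ge0.
apply: filterS2 gae0 Ygt0 => w /= /(_ I) [/eqP].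
(* The quotient is also 0 when [Y w = 0], by the convention on inverses; positivity rules this
   out. *)
rewrite mulf_eq0 sqrf_eq0 subr_eq0 invr_eq0 => /orP[/eqP//|/eqP ->].
by rewrite ltxx.
Qed.

Lemma expectation_ae_cst (d : measure_display) (T : measurableType d)
    (R : realType) (P : probability T R) (Y : T -> R) (c : R) :
  measurable_fun [set: T] Y -> {ae P, forall w, Y w = c} ->
  ('E_P[Y] = c%:E)%E.
Proof.
move=> mY Yc; rewrite -(expectation_cst P c) unlock.
apply: ae_eq_integral => //.
- exact/measurable_EFinP.
- exact/measurable_EFinP.
- by apply: filterS Yc => w /= ->.
Qed.

(** * Null sets of Lebesgue measure against null sets of the law of [X] *)

Lemma density_ae (d : measure_display) (T : measurableType d) (R : realType)
    (P : probability T R) (X : {RV P >-> R}) (f : R -> R) (Q : R -> Prop) :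
  is_density X f -> {ae lebesgue_measure, forall t, Q t} ->
  {ae P, forall w, Q (X w)}.
Proof.
move=> [mf f0 Xf] [N [mN N0 subN]]; exists (X @^-1` N); split.
- exact: measurable_funPTI.
(* The mass of [N] under the law of [X] is the integral of [f] over a Lebesgue-null set. *)
- rewrite -[LHS]/(distribution P X N) Xf//.
  have mfN : measurable_fun N (EFin \o f).
    by apply/measurable_EFinP; exact: measurable_funTS.
  rewrite -(@integral_abs_eq0 _ _ _ lebesgue_measure _ _ mN mfN N0).
  by apply: eq_integral => t _ /=; rewrite ger0_norm.
- by move=> w /= /subN.
Qed.

(** The way back from [P] to Lebesgue measure: a nonnegative density with integral 0 over [A]
    vanishes almost everywhere there. *)
Lemma density_eq0 (d : measure_display) (T : measurableType d) (R : realType)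
    (P : probability T R) (X : {RV P >-> R}) (f : R -> R) (A : set R) :
  is_density X f -> measurable A ->
  {ae P, forall w, ~ A (X w)} ->
  {ae lebesgue_measure, forall t, A t -> f t = 0}.
Proof.
move=> [mf f0 Xf] mA XA.
have PA0 : P (X @^-1` A) = 0%E.
  apply: measure_negligible; first exact: measurable_funPTI.
  by apply: negligibleS XA => w /= Aw; exact.
have mfA : measurable_fun A (EFin \o f).
  by apply/measurable_EFinP; exact: measurable_funTS.
have /(ae_eq_integral_abs lebesgue_measure mA mfA) :
    (\int[lebesgue_measure]_(t in A) `|(EFin \o f) t| = 0)%E.
  rewrite -PA0 -[RHS]/(distribution P X A) Xf//.
  by apply: eq_integral => t _ /=; rewrite ger0_norm.
by apply: filterS => t /= ft At; have [] := ft At.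
Qed.

Lemma density_gt0 (d : measure_display) (T : measurableType d) (R : realType)
    (P : probability T R) (X : {RV P >-> R}) (f : R -> R) :
  is_density X f -> {ae P, forall w, 0 < f (X w)}.
Proof.
move=> [mf f0 Xf].
have mA : measurable (f @^-1` [set 0]).
  by rewrite -[X in measurable X]setTI; exact: mf.
exists (X @^-1` (f @^-1` [set 0])); split.
- exact: measurable_funPTI.
- rewrite -[LHS]/(distribution P X _) Xf//.
  by apply: integral0_eq => t /= ->.
- by move=> w /= /negP; rewrite lt_def f0 andbT negbK => /eqP.
Qed.

Lemma density_integrable (d : measure_display) (T : measurableType d)
    (R : realType) (P : probability T R) (X : {RV P >-> R}) (f : R -> R) :
  is_density X f -> lebesgue_measure.-integrable [set: R] (EFin \o f).
Proof.
move=> [mf f0 Xf]; apply/integrableP; split; first exact/measurable_EFinP.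
have -> : (\int[lebesgue_measure]_t `|(EFin \o f) t| =
    \int[lebesgue_measure]_t (f t)%:E)%E.
  by apply: eq_integral => t _ /=; rewrite ger0_norm.
by rewrite -Xf// probability_setT ltry.
Qed.

(** * The distribution function: monotonicity, continuity, endpoints *)

Lemma cdf_fineK (d : measure_display) (T : measurableType d) (R : realType)
    (P : probability T R) (X : {RV P >-> R}) (t : R) :
  (fine (cdf X t))%:E = cdf X t.
Proof. by rewrite fineK// fin_num_measure. Qed.

Lemma fine_cdf_ge0 (d : measure_display) (T : measurableType d) (R : realType)
    (P : probability T R) (X : {RV P >-> R}) (t : R) : 0 <= fine (cdf X t).
Proof. by rewrite fine_ge0// cdf_ge0. Qed.

Lemma fine_cdf_le1 (d : measure_display) (T : measurableType d) (R : realType)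
    (P : probability T R) (X : {RV P >-> R}) (t : R) : fine (cdf X t) <= 1.
Proof. by rewrite -lee_fin cdf_fineK cdf_le1. Qed.

Lemma fine_cdf_nondecreasing (d : measure_display) (T : measurableType d)
    (R : realType) (P : probability T R) (X : {RV P >-> R}) (s t : R) :
  s <= t -> fine (cdf X s) <= fine (cdf X t).
Proof. by move=> st; rewrite -lee_fin !cdf_fineK; exact: cdf_nondecreasing. Qed.

Lemma density_cdfB (d : measure_display) (T : measurableType d)
    (R : realType) (P : probability T R) (X : {RV P >-> R}) (f : R -> R)
    (s t : R) : is_density X f -> s <= t ->
  fine (cdf X t) - fine (cdf X s) = \int[lebesgue_measure]_(x in `]s, t]) f x.
Proof.
move=> fX st; have [mf f0 Xf] := fX.
rewrite /cdf !Xf// -(Rintegral_itvB (a := -oo%O))//.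
exact: integrableS (density_integrable fX).
Qed.

(** Absolute continuity of the integral: [f] has small integral over short intervals, and these
    integrals are the increments of the distribution function. *)
Lemma density_cdf_continuous (d : measure_display) (T : measurableType d)
    (R : realType) (P : probability T R) (X : {RV P >-> R}) (f : R -> R) :
  is_density X f -> continuous (fun t => fine (cdf X t)).
Proof.
move=> fX x; have [mf f0 Xf] := fX; apply/cvgrPdist_lt => e e0.
have [r [r0 fr]] := integral_normr_continuous (density_integrable fX) e0.
have close (s t : R) : s <= t -> t - s < r ->
    `|fine (cdf X t) - fine (cdf X s)| < e.
  move=> st tsr; rewrite ger0_norm ?subr_ge0 ?fine_cdf_nondecreasing//.
  rewrite (density_cdfB fX st).
  rewrite (_ : Rintegral _ _ _ =
    \int[lebesgue_measure]_(x in `]s, t]) `|f x|); last first.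
    by apply: eq_Rintegral => z _; rewrite ger0_norm.
  apply: fr => //; rewrite [X in (X < _)%E]lebesgue_measure_itv/= lte_fin.
  by case: ifP => _; rewrite ?lte_fin// -EFinD lte_fin.
near=> t; have : `|x - t| < r by near: t; exact: cvgr_dist_lt.
have [xt|tx] := leP x t.
  by rewrite distrC ger0_norm ?subr_ge0// => /(close _ _ xt); rewrite distrC.
by rewrite gtr0_norm ?subr_gt0// => /(close _ _ (ltW tx)).
Unshelve. all: by end_near. Qed.

Lemma measurable_fine_cdf (d : measure_display) (T : measurableType d)
    (R : realType) (P : probability T R) (X : {RV P >-> R}) :
  measurable_fun [set: R] (fun t => fine (cdf X t)).
Proof.
apply: nondecreasing_measurable => //.
by move=> s t; exact: fine_cdf_nondecreasing.
Qed.

Lemma measurable_reversed_hazard (d : measure_display) (T : measurableType d)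
    (R : realType) (P : probability T R) (X : {RV P >-> R}) (f : R -> R) :
  is_density X f -> measurable_fun [set: R] (reversed_hazard X f).
Proof.
move=> [mf _ _]; apply: measurable_funM => //.
apply: measurable_fun_inv_ge0; first exact: measurable_fine_cdf.
exact: fine_cdf_ge0.
Qed.

Lemma reversed_hazard_ge0 (d : measure_display) (T : measurableType d)
    (R : realType) (P : probability T R) (X : {RV P >-> R}) (f : R -> R)
    (t : R) : is_density X f -> 0 <= reversed_hazard X f t.
Proof. by move=> [_ f0 _]; rewrite /reversed_hazard divr_ge0 ?fine_cdf_ge0. Qed.

Lemma fine_cdf_gt0 (d : measure_display) (T : measurableType d)
    (R : realType) (P : probability T R) (X : {RV P >-> R}) (a : \bar R)
    (t : R) :
  a = ereal_inf [set t%:E | t in [set t : R | (0 < cdf X t)%E]] ->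
  (a < t%:E)%E -> 0 < fine (cdf X t).
Proof.
move=> ->; move=> /ereal_inf_lt[_ [s /= s0 <-]]; rewrite lte_fin => /ltW st.
by apply: lt_le_trans (fine_cdf_nondecreasing X st); rewrite -lte_fin cdf_fineK.
Qed.

Lemma fine_cdf_eq0 (d : measure_display) (T : measurableType d)
    (R : realType) (P : probability T R) (X : {RV P >-> R}) (a : \bar R)
    (t : R) :
  a = ereal_inf [set t%:E | t in [set t : R | (0 < cdf X t)%E]] ->
  (t%:E < a)%E -> fine (cdf X t) = 0.
Proof.
move=> -> ta; apply/eqP; rewrite eq_le fine_cdf_ge0 andbT leNgt.
apply/negP => Ft; move: ta; rewrite ltNge => /negP; apply.
by apply: ereal_inf_lbound; exists t => //=; rewrite -cdf_fineK lte_fin.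
Qed.

Lemma fine_cdf_eq1 (d : measure_display) (T : measurableType d)
    (R : realType) (P : probability T R) (X : {RV P >-> R}) (b : \bar R)
    (t : R) :
  b = ereal_sup [set t%:E | t in [set t : R | (cdf X t < 1)%E]] ->
  (b < t%:E)%E -> fine (cdf X t) = 1.
Proof.
move=> -> bt; apply/eqP; rewrite eq_le fine_cdf_le1 leNgt.
apply/negP => Ft; move: bt; rewrite ltNge => /negP; apply.
by apply: ereal_sup_ubound; exists t => //=; rewrite -cdf_fineK lte_fin.
Qed.

Lemma fine_cdf_endpoint (d : measure_display) (T : measurableType d)
    (R : realType) (P : probability T R) (X : {RV P >-> R}) (f : R -> R)
    (b : R) :
  is_density X f ->
  b%:E = ereal_sup [set t%:E | t in [set t : R | (cdf X t < 1)%E]] ->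
  fine (cdf X b) = 1.
Proof.
move=> fX supp; apply/eqP; rewrite eq_le fine_cdf_le1 leNgt.
apply/negP => Fb1; have Fcont := density_cdf_continuous fX.
have : \forall t \near b, fine (cdf X t) < 1 by exact: (cvgr_lt _ (Fcont b)).
move=> [e /= e0 eb].
(* A point just beyond [b], where the distribution function is already 1. *)
have /eb /= : ball_ [eta Num.Def.normr] b e (b + e / 2).
  rewrite /= opprD addNKr normrN gtr0_norm ?divr_gt0//.
  by rewrite ltr_pdivrMr// ltr_pMr// ltr1n.
by rewrite (fine_cdf_eq1 supp) ?ltxx// lte_fin ltrDl divr_gt0.
Qed.

(** For a finite endpoint [r], the event [X < r] is a countable union of the null events
    [X <= r - 1/(n+1)], and the point [r] itself is null because [X] has a density. *)
Lemma lower_endpoint_lt_ae (d : measure_display) (T : measurableType d)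
    (R : realType) (P : probability T R) (X : {RV P >-> R}) (f : R -> R)
    (a : \bar R) : is_density X f ->
  a = ereal_inf [set t%:E | t in [set t : R | (0 < cdf X t)%E]] ->
  a != +oo%E -> {ae P, forall w, (a < (X w)%:E)%E}.
Proof.
move=> fX; case: a => [r| |] aE // _; last by apply: aeW => w; rewrite ltNyr.
have rX (n : nat) : {ae P, forall w, r - n.+1%:R^-1 < X w}.
  exists (X @^-1` `]-oo, r - n.+1%:R^-1]); split.
  - exact: measurable_funPTI.
  - rewrite -[LHS]/(cdf X _) -cdf_fineK (fine_cdf_eq0 aE)//.
    by rewrite lte_fin ltrBlDr ltrDl invr_gt0.
  - by move=> w /= /negP; rewrite -leNgt in_itv.
have rNX : {ae P, forall w, X w <> r}.
  apply: (density_ae fX (Q := fun t => t <> r)).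
  exists [set r]; split => //; first exact: lebesgue_measure_set1.
  by move=> t /= /contrapT.
apply: filterS2 (ae_foralln rX) rNX => w rw /eqP wr.
rewrite lte_fin lt_neqAle eq_sym wr/= leNgt; apply/negP => wltr.
have [n] := ltr_add_invr wltr.
by rewrite -ltrBrDr ltNge ltW.
Qed.

(** * The differential equation satisfied by the distribution function *)

Lemma exp_growth (R : realType) (G : R -> R) (c b : R) :
  continuous G -> (forall t, t < b -> is_derive t 1 G (c * G t)) ->
  forall t, t <= b -> G t = G b * expR (c * (t - b)).
Proof.
move=> Gcont dG t; rewrite le_eqVlt => /predU1P[->|tb].
  by rewrite subrr mulr0 expR0 mulr1.
(* Integrating factor: [K] has derivative 0 left of [b]. Continuity carries the mean value theorem
   up to [b], where no derivative is assumed. *)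
pose K x := G x * expR (c * (b - x)).
have Kcont : continuous K.
  move=> x; apply: cvgM; first exact: Gcont.
  apply: continuous_cvg; first exact: continuous_expR.
  by apply: cvgMr; apply: cvgB; [exact: cvg_cst|exact: cvg_id].
have dK x : x \in `]t, b[ -> is_derive x 1 K 0.
  rewrite in_itv/= => /andP[_ xb]; have dGx := dG _ xb.
  apply: is_derive_eq; rewrite /GRing.scale/=.
  by ring.
have [x _] := MVT tb dK (continuous_subspaceT Kcont).
rewrite mul0r /K subrr mulr0 expR0 mulr1 => /eqP; rewrite subr_eq0 => /eqP ->.
by rewrite -mulrA -expRD -mulrDr addrA subrK subrr mulr0 expR0 mulr1.
Qed.

(** A bootstrap from almost everywhere to everywhere: replacing [f] by the continuous [h] leaves the
    integrals unchanged, so the fundamental theorem applies at each point left of [b]. *)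
Lemma density_cdf_derive (d : measure_display) (T : measurableType d)
    (R : realType) (P : probability T R) (X : {RV P >-> R}) (f : R -> R)
    (c b t : R) : is_density X f ->
  {ae lebesgue_measure, forall t, t < b -> f t = c * fine (cdf X t)} ->
  t < b -> is_derive t 1 (fun s => fine (cdf X s)) (c * fine (cdf X t)).
Proof.
move=> fX fE tb; have [mf f0 Xf] := fX.
pose h s := c * fine (cdf X s).
have mh : measurable_fun [set: R] h.
  by apply: measurable_funM => //; exact: measurable_fine_cdf.
have fh (u : R) : u < b ->
    ae_eq lebesgue_measure `]-oo, u]%classic (EFin \o f) (EFin \o h).
  move=> ub; apply: filterS fE => s fs /=; rewrite in_itv/= => su.
  by rewrite fs// (le_lt_trans su).
have mfu (u : R) : measurable_fun `]-oo, u] (EFin \o f).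
  by apply/measurable_EFinP; exact: measurable_funTS.
have mhu (u : R) : measurable_fun `]-oo, u] (EFin \o h).
  by apply/measurable_EFinP; exact: measurable_funTS.
have FE (u : R) : u < b ->
    \int[lebesgue_measure]_(s in `]-oo, u]) h s = fine (cdf X u).
  move=> ub; rewrite /cdf Xf//; congr fine; apply/esym.
  by apply: ae_eq_integral => //; [exact: mfu|exact: mhu|exact: fh].
(* The fundamental theorem needs room to the right of [t], while [f] and [h] are only known to agree
   left of [b]. *)
have [u tu ub] : exists2 u, t < u & u < b.
  by exists ((t + b) / 2); rewrite midf_lt.
have ih : lebesgue_measure.-integrable `]-oo, u] (EFin \o h).
  have ifu : lebesgue_measure.-integrable `]-oo, u] (EFin \o f).
    exact: integrableS (density_integrable fX).
  move/integrableP : ifu => [_ fuoo]; apply/integrableP.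
  split; first exact: mhu.
  apply: le_lt_trans fuoo; rewrite le_eqVlt; apply/orP; left; apply/eqP.
  apply: ae_eq_integral => //.
  - by apply: measurableT_comp => //; exact: mhu.
  - by apply: measurableT_comp => //; exact: mfu.
  - by apply: ae_eq_abse; apply: ae_eq_sym; exact: fh.
have hcont : {for t, continuous h}.
  by apply: cvgMr; exact: (density_cdf_continuous fX).
have [dH HE] := continuous_FTC1 (a := -oo%O) tu ih (ltNyr t) hcont.
rewrite -[c * _]/(h t) -HE derive1E.
apply: near_eq_is_derive (derivableP dH).
near=> s; apply: FE; near: s.
exact: lt_nbhsl.
Unshelve. all: by end_near. Qed.

(** * The reversed hazard rate along [X], and the density it determines *)

Lemma reversed_hazard_gt0_ae (d : measure_display) (T : measurableType d)
    (R : realType) (P : probability T R) (X : {RV P >-> R}) (f : R -> R)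
    (a b : \bar R) : is_density X f -> has_support X a b -> (a < b)%E ->
  {ae P, forall w, 0 < reversed_hazard X f (X w)}.
Proof.
move=> fX [aE _] ab.
have aoo : a != +oo%E by rewrite lt_eqF// (lt_le_trans ab)// leey.
apply: filterS2 (density_gt0 fX) (lower_endpoint_lt_ae fX aE aoo) => w fw aw.
by rewrite divr_gt0// (fine_cdf_gt0 aE).
Qed.

Lemma upper_endpoint_gt_ae (d : measure_display) (T : measurableType d)
    (R : realType) (P : probability T R) (X : {RV P >-> R}) (f : R -> R)
    (b : R) :
  is_density X f -> fine (cdf X b) = 1 -> {ae P, forall w, X w < b}.
Proof.
move=> fX Fb.
have XNb : {ae P, forall w, X w <> b}.
  apply: (density_ae fX (Q := fun t => t <> b)).
  exists [set b]; split => //; first exact: lebesgue_measure_set1.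
  by move=> t /= /contrapT.
have Xb : {ae P, forall w, X w <= b}.
  exists (X @^-1` `]b, +oo[); split.
  - exact: measurable_funPTI.
  - have := cdf_ccdf_1 X b; rewrite -cdf_fineK Fb.
    move=> /(congr1 (fun x => x - 1%:E)%E).
    by rewrite addeAC subee// add0e.
  - by move=> w /= /negP; rewrite -ltNge in_itv/= andbT.
by apply: filterS2 XNb Xb => w /eqP Xwb; rewrite lt_neqAle Xwb.
Qed.

(** The density vanishes almost everywhere on the set where the hazard rate differs from [c]; since
    [f] is positive on the support, that set is negligible there. *)
Lemma reversed_hazard_cst_density (d : measure_display) (T : measurableType d)
    (R : realType) (P : probability T R) (X : {RV P >-> R}) (f : R -> R)
    (a : \bar R) (b c : R) :
  is_density X f -> has_support X a b%:E -> (a < b%:E)%E ->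
  {ae lebesgue_measure, forall t : R, (a < t%:E < b%:E)%E -> 0 < f t} ->
  {ae P, forall w, reversed_hazard X f (X w) = c} ->
  {ae lebesgue_measure, forall t, t < b -> f t = c * fine (cdf X t)}.
Proof.
move=> fX [aE bE] ab f_gt0 phi_c.
have aoo : a != +oo%E by rewrite lt_eqF// (lt_le_trans ab)// leey.
have mphi := measurable_reversed_hazard fX.
have phiA : {ae lebesgue_measure, forall t,
    (reversed_hazard X f @^-1` [set~ c]) t -> f t = 0}.
  apply: (density_eq0 fX).
    rewrite -[X in measurable X]setTI; apply: mphi => //.
    exact: measurableC.
  by apply: filterS phi_c => w /= ->; apply.
have belowA : {ae lebesgue_measure, forall t,
    [set t | (t%:E <= a)%E] t -> f t = 0}.
  apply: (density_eq0 fX).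
    case: (a) => [r| |] /=.
    - by rewrite (_ : [set _ | _] = `]-oo, r]%classic).
    - rewrite (_ : [set _ | _] = setT)//.
      by apply/seteqP; split => // t _ /=; rewrite leey.
    - by rewrite (_ : [set _ | _] = set0)//; apply/seteqP; split.
  apply: filterS (lower_endpoint_lt_ae fX aE aoo) => w aw /=.
  by rewrite leNgt aw.
apply: filterS3 f_gt0 phiA belowA => t ft phit fa tb.
(* At or below [a] both sides are 0: [X] exceeds [a] almost surely, so neither density nor
   distribution function has mass there. *)
have [ta|at'] := leP (t%:E) a.
  rewrite fa//.
  rewrite /cdf (_ : distribution P X _ = 0%E) ?mulr0//.
  rewrite /distribution /pushforward; apply: measure_negligible.
    exact: measurable_funPTI.
  apply: negligibleS (lower_endpoint_lt_ae fX aE aoo) => w /=.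
  rewrite in_itv/= => Xt; apply/negP; rewrite -leNgt.
  by rewrite (le_trans _ ta)// lee_fin.
have Ft := fine_cdf_gt0 aE at'.
have {}ft : 0 < f t by apply: ft; rewrite at' lte_fin.
have <- : reversed_hazard X f t = c.
  by apply: contrapT => /phit ft0; rewrite ft0 ltxx in ft.
by rewrite /reversed_hazard divfK// gt_eqF.
Qed.

Lemma type3_density (d : measure_display) (T : measurableType d)
    (R : realType) (P : probability T R) (X : {RV P >-> R}) (f : R -> R)
    (b g : R) : is_density X f ->
  (forall t, cdf X t = (type3_extreme_cdf g b t)%:E) ->
  {ae lebesgue_measure, forall t, t < b -> f t = g * fine (cdf X t)}.
Proof.
move=> fX FE; have intf := density_integrable fX; have [mf f0 Xf] := fX.
have intfy y : lebesgue_measure.-integrable `]-oo, y] (EFin \o f).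
  exact: integrableS intf.
have locf : locally_integrable [set: R] f.
  by apply: open_integrable_locally => //; exact: openT.
apply: filterS (FTC1Ny intfy locf) => t [_ <-] tb.
rewrite derive1E.
(* A derivative is local: all points near [t < b] lie on the exponential branch. *)
rewrite (@near_eq_derive _ _ _ _ (fun s => expR (g * (s - b)))); last first.
  near=> s; rewrite /Rintegral -Xf// -[distribution _ _ _]/(cdf X s) FE/=.
  rewrite /type3_extreme_cdf ifT//; apply: ltW; near: s.
  exact: lt_nbhsl.
rewrite FE/= /type3_extreme_cdf (ltW tb).
apply: derive_val; apply: is_derive_eq; rewrite /GRing.scale/=.
by ring.
Unshelve. all: by end_near. Qed.

Unset Implicit Arguments.
Set Strict Implicit.

(** Positivity of [f] inside the support excludes gaps: across a gap the distribution function is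
    flat, yet [phi (X w)] could still be almost surely constant. *)
Theorem theorem2p1 (d : measure_display) (T : measurableType d) (R : realType)
    (P : probability T R) (X : {RV P >-> R}) (f : R -> R) (a : \bar R) (b : R)
    (f_density : is_density X f)
    (X_support : has_support X a b%:E) (lt_ab : (a < b%:E)%E)
    (X_second_moment : ('E_P[fun w => (X w ^+ 2)%R] < +oo)%E) :
  let phi := reversed_hazard X f in
  ('E_P[fun w => (phi (X w))^-1%R] >= ('E_P[fun w => phi (X w)])^-1)%E /\
  ({ae lebesgue_measure, forall t : R, (a < t%:E < b%:E)%E -> 0 < f t} ->
   (('E_P[fun w => (phi (X w))^-1%R] = ('E_P[fun w => phi (X w)])^-1)%E <->
    exists2 gamma : R, 0 < gamma &
      forall t : R, cdf X t = (type3_extreme_cdf gamma b t)%:E)).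
Proof.
move=> phi.
have mphi : measurable_fun [set: T] (fun w => phi (X w)).
  exact: (measurableT_comp (measurable_reversed_hazard f_density)).
have phi0 w : 0 <= phi (X w) by exact: reversed_hazard_ge0.
have phi_gt0 : {ae P, forall w, 0 < phi (X w)}.
  exact: reversed_hazard_gt0_ae X_support lt_ab.
have Fb : fine (cdf X b) = 1.
  by apply: fine_cdf_endpoint f_density _; case: X_support.
split; first exact: expectation_inv_ge.
move=> f_gt0; split.
- move=> /(expectation_inv_eq mphi phi0 phi_gt0)[c c0 phi_c]; exists c => // t.
  have fE := reversed_hazard_cst_density f_density X_support lt_ab f_gt0 phi_c.
  rewrite -cdf_fineK /type3_extreme_cdf; congr EFin; case: ifPn => [tb|].
    have dF s : s < b -> is_derive s 1 (fun s => fine (cdf X s))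
        (c * fine (cdf X s)) by exact: (density_cdf_derive f_density fE).
    by rewrite (exp_growth (density_cdf_continuous f_density) dF tb) Fb mul1r.
  rewrite -ltNge => bt; case: X_support => _ bE.
  by rewrite (fine_cdf_eq1 bE).
- move=> [g g0 FE].
  have phi_g : {ae P, forall w, phi (X w) = g}.
    have fE := density_ae f_density (type3_density f_density FE).
    have Xb : {ae P, forall w, X w < b}.
      exact: upper_endpoint_gt_ae f_density Fb.
    (* Almost surely [X] falls where [f = g F] holds and where [F] is an exponential, hence nonzero,
       so the quotient is [g]. *)
    apply: filterS2 fE Xb => w fw Xwb.
    rewrite /phi /reversed_hazard fw// mulfK// FE/= /type3_extreme_cdf ltW//.
    by rewrite gt_eqF// expR_gt0.
  rewrite (expectation_ae_cst mphi phi_g) inver gt_eqF//.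
  apply: expectation_ae_cst; first exact: measurable_fun_inv_ge0.
  by apply: filterS phi_g => w ->.
Qed.
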